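(* Let $\omega=\sum_{d_1,d_2\ge0}\omega_{d_1,d_2}$ and $\bar\omega=\sum_{d_1,d_2\ge0}\bar\omega_{d_1,d_2}$ be the Whittaker vector in the Verma module $\mathcal V_v$ over $U_v(\mathfrak{sl}_3)$ and the dual Whittaker vector in the Verma module $\mathcal V_{v^{-1}}$ over $U_{v^{-1}}(\mathfrak{sl}_3)$. Under the identification $q=v^2$, $z_1=q^{\lambda_1-\lambda_2+1}$, $z_2=q^{\lambda_2-\lambda_3+1}$, for all integers $d_1,d_2\ge0$, $$I_{d_1,d_2}(z_1,z_2)=(\omega_{d_1,d_2},\bar \omega_{d_1,d_2}),$$ where $$I_{d_1,d_2}(z_1,z_2)=\frac{(q z_1^{-1} z_2^{-1})_{d_1+d_2}}{(q)_{d_1} (q)_{d_2}(qz_1^{-1})_{d_1} (qz_2^{-1})_{d_2}(q z_1^{-1} z_2^{-1})_{d_1}(q z_1^{-1} z_2^{-1})_{d_2}}.$$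
   Context: $(a)_n=\prod_{i=0}^{n-1}(1-aq^i)$. **Quantum groups.** $U_v(\mathfrak{sl}_3)$ is the $\mathbb C(v)$-algebra with generators $K_i^{\pm1},E_i,F_i$ ($i=1,2$) and relations, for $i\ne j$: $K_iK_i^{-1}=1$, $K_iK_j=K_jK_i$, $K_iE_i=v^2E_iK_i$, $K_iF_i=v^{-2}F_iK_i$, $K_iE_j=v^{-1}E_jK_i$, $K_iF_j=vF_jK_i$, $E_iF_i-F_iE_i=\frac{K_i-K_i^{-1}}{v-v^{-1}}$, $E_iF_j=F_jE_i$, $E_i^2E_j-(v+v^{-1})E_iE_jE_i+E_jE_i^2=0$, $F_i^2F_j-(v+v^{-1})F_iF_jF_i+F_jF_i^2=0$. $U_{v^{-1}}(\mathfrak{sl}_3)$ is the same with $v$ replaced by $v^{-1}$; its generators are written $\bar K_i^{\pm1},\bar E_i,\bar F_i$. Let $\sigma:U_v(\mathfrak{sl}_3)\to U_{v^{-1}}(\mathfrak{sl}_3)$ be the $\mathbb C(v)$-algebra isomorphism $E_i\mapsto\bar E_i$, $F_i\mapsto\bar F_i$, $K_i\mapsto\bar K_i^{-1}$, and $\tau$ the anti-automorphism $E_i\mapsto F_i$, $F_i\mapsto E_i$, $K_i\mapsto K_i$ of $U_v(\mathfrak{sl}_3)$. **Verma modules.** $\lambda_1,\lambda_2$ are formal variables, $\lambda_3=-\lambda_1-\lambda_2$; scalars are extended to the ring $\mathcal R$ spanned by all square roots $\sqrt g$, $g\in\mathbb C(v,v^{\lambda_1},v^{\lambda_2})$ (inside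 a fixed algebraic closure). $\mathcal V_v$ is the $U_v(\mathfrak{sl}_3)$-module generated by $w$ with defining relations $K_1w=v^{\lambda_1-\lambda_2}w$, $K_2w=v^{\lambda_2-\lambda_3}w$, $E_1w=E_2w=0$. $\mathcal V_{v^{-1}}$ is the $U_{v^{-1}}(\mathfrak{sl}_3)$-module generated by $\bar w$ with defining relations $\bar K_1\bar w=v^{\lambda_2-\lambda_1}\bar w$, $\bar K_2\bar w=v^{\lambda_3-\lambda_2}\bar w$, $\bar E_1\bar w=\bar E_2\bar w=0$. Weight spaces: $\mathcal V_v(d_1,d_2)$ is the subspace where $K_1=v^{\lambda_1-\lambda_2-2d_1+d_2}$, $K_2=v^{\lambda_2-\lambda_3-2d_2+d_1}$; $\mathcal V_{v^{-1}}(d_1,d_2)$ is the subspace where $\bar K_1=v^{\lambda_2-\lambda_1+2d_1-d_2}$, $\bar K_2=v^{\lambda_3-\lambda_2+2d_2-d_1}$. There is a unique non-degenerate $\mathcal R$-bilinear pairing $(\ ,\ ):\mathcal V_v\otimes\mathcal V_{v^{-1}}\to\mathcal R$ with $(w,\bar w)=1$ and $(gw_1,\bar w_2)=(w_1,(\sigma\circ\tau)(g)\bar w_2)$ for all $g\in U_v(\mathfrak{sl}_3)$, $w_1\in\mathcal V_v$, $\bar w_2\in\mathcal V_{v^{-1}}$. **Whittaker vectors** (they exist and are unique). The Whittaker vector is the series $\omega=\sum_{d_1,d_2\ge0}\omega_{d_1,d_2}$, $\omega_{d_1,d_2}\in\mathcal V_v(d_1,d_2)$, with $\omega_{0,0}=w$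 and $E_1K_1^{-1}\omega_{d_1,d_2}=\frac1{1-v^2}\omega_{d_1-1,d_2}$, $E_2\omega_{d_1,d_2}=\frac1{1-v^2}\omega_{d_1,d_2-1}$. The dual Whittaker vector is the series $\bar\omega=\sum_{d_1,d_2\ge0}\bar\omega_{d_1,d_2}$, $\bar\omega_{d_1,d_2}\in\mathcal V_{v^{-1}}(d_1,d_2)$, with $\bar\omega_{0,0}=\bar w$ and $\bar E_1\bar\omega_{d_1,d_2}=\frac v{1-v^{-2}}\bar\omega_{d_1-1,d_2}$, $\bar E_2\bar K_2\bar\omega_{d_1,d_2}=\frac v{1-v^{-2}}\bar\omega_{d_1,d_2-1}$. Terms with a negative index are zero. *)

(* Defs.v *)
From HB Require Import structures.
From mathcomp Require Import all_boot all_order all_algebra.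
From mathcomp Require Import complex mpoly.
From mathcomp Require Import boolp reals.

Set Implicit Arguments.
Unset Strict Implicit.
Unset Printing Implicit Defensive.

Import GRing.Theory.

Local Open Scope ring_scope.

Section SqrtRing.

Variables (F : fieldType) (L : closedFieldType) (iota : {rmorphism F -> L}).

Definition is_algebraic_closure : Prop := forall x : L, algebraicOver iota x.

(* The F-span of all square roots (in L) of elements of F: it is closed under
   products, as s ^+ 2 = iota g and s' ^+ 2 = iota g' give
   (s * s') ^+ 2 = iota (g * g'). *)
Inductive sqrt_span : L -> Prop :=
| SqrtSpan0 : sqrt_span 0
| SqrtSpanD (c g : F) (s x : L) :
    s ^+ 2 = iota g -> sqrt_span x -> sqrt_span (iota c * s + x).

Definition in_sqrt_span : {pred L} := fun x => `[< sqrt_span x >].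

Lemma sqrt_span_sqrt (c g : F) (s : L) :
  s ^+ 2 = iota g -> sqrt_span (iota c * s).
Proof. by move=> Hs; rewrite -[_ * _]addr0; apply: (SqrtSpanD c Hs); constructor. Qed.

Lemma sqrt_span_base (c : F) : sqrt_span (iota c).
Proof.
rewrite -[iota c]mulr1; apply: (@sqrt_span_sqrt c 1).
by rewrite expr1n rmorph1.
Qed.

Lemma sqrt_spanD (x y : L) : sqrt_span x -> sqrt_span y -> sqrt_span (x + y).
Proof.
move=> Hx Hy; elim: Hx => [|c g s z Hs _ IH]; first by rewrite add0r.
by rewrite -addrA; apply: (SqrtSpanD c Hs).
Qed.

Lemma sqrt_spanN (x : L) : sqrt_span x -> sqrt_span (- x).
Proof.
elim=> [|c g s z Hs _ IH]; first by rewrite oppr0; constructor.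
by rewrite opprD -mulNr -rmorphN; apply: (SqrtSpanD _ Hs).
Qed.

Lemma sqrt_spanM (x y : L) : sqrt_span x -> sqrt_span y -> sqrt_span (x * y).
Proof.
elim=> [|c g s z Hs _ IH] Hy; first by rewrite mul0r; constructor.
rewrite mulrDl; apply: sqrt_spanD; last exact: IH.
elim: Hy => [|c' g' s' z' Hs' _ IH']; first by rewrite mulr0; constructor.
rewrite mulrDr mulrACA -rmorphM.
by apply: (@SqrtSpanD _ (g * g')) => //; rewrite exprMn Hs Hs' rmorphM.
Qed.

Lemma in_sqrt_span_subring : subring_closed in_sqrt_span.
Proof.
split=> [|x y /asboolP Hx /asboolP Hy|x y /asboolP Hx /asboolP Hy]; apply/asboolP.
- by rewrite -(rmorph1 iota); exact: sqrt_span_base.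
- by apply: sqrt_spanD => //; exact: sqrt_spanN.
- exact: sqrt_spanM.
Qed.

HB.instance Definition _ :=
  GRing.isSubringClosed.Build L in_sqrt_span in_sqrt_span_subring.

Record sqrt_ring : Type := SqrtRing {
  sqrt_ring_val :> L;
  _ : sqrt_ring_val \in in_sqrt_span
}.

HB.instance Definition _ := [isSub for sqrt_ring_val].
HB.instance Definition _ := [Choice of sqrt_ring by <:].
HB.instance Definition _ := [SubChoice_isSubComNzRing of sqrt_ring by <:].

Lemma in_sqrt_span_base (c : F) : iota c \in in_sqrt_span.
Proof. by apply/asboolP; exact: sqrt_span_base. Qed.

Definition to_sqrt_ring (c : F) : sqrt_ring := SqrtRing (in_sqrt_span_base c).

Fact to_sqrt_ring_is_additive : zmod_morphism to_sqrt_ring.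
Proof. by move=> a b; apply: val_inj; rewrite /= rmorphB. Qed.

Fact to_sqrt_ring_is_multiplicative : monoid_morphism to_sqrt_ring.
Proof. by split=> [|a b]; apply: val_inj; rewrite /= ?rmorph1 ?rmorphM. Qed.

HB.instance Definition _ :=
  GRing.isZmodMorphism.Build F sqrt_ring to_sqrt_ring to_sqrt_ring_is_additive.
HB.instance Definition _ :=
  GRing.isMonoidMorphism.Build F sqrt_ring to_sqrt_ring
    to_sqrt_ring_is_multiplicative.

End SqrtRing.

Section BaseFields.

Variable R : realType.

Definition Cv : fieldType := {fraction {poly R[i]}}.
Definition v0 : Cv := tofrac 'X.

(* C(v, v^lambda_1, v^lambda_2): the formal exponents lambda_1, lambda_2 enter
   only through v^lambda_1 = 'X_0 and v^lambda_2 = 'X_1, and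
   lambda_3 = - lambda_1 - lambda_2 through [vlam3] below. *)
Definition Cvl : fieldType := {fraction {mpoly Cv[2]}}.

Definition Cv_to_Cvl (c : Cv) : Cvl := tofrac (mpolyC 2 c).

Definition v : Cvl := Cv_to_Cvl v0.
Definition vlam1 : Cvl := tofrac ('X_(ord0 : 'I_2) : {mpoly Cv[2]}).
Definition vlam2 : Cvl := tofrac ('X_(ord_max : 'I_2) : {mpoly Cv[2]}).
Definition vlam3 : Cvl := (vlam1 * vlam2)^-1.

(* q^lambda_i = (v^lambda_i) ^+ 2 since q = v ^+ 2 *)
Definition q : Cvl := v ^+ 2.
Definition z1 : Cvl := (vlam1 / vlam2) ^+ 2 * q.
Definition z2 : Cvl := (vlam2 / vlam3) ^+ 2 * q.

Definition qpoch (a : Cvl) (n : nat) : Cvl := \prod_(i < n) (1 - a * q ^+ i).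

Definition Ifun (d1 d2 : nat) (y1 y2 : Cvl) : Cvl :=
  qpoch (q * y1^-1 * y2^-1) (d1 + d2)
  / (qpoch q d1 * qpoch q d2 * qpoch (q * y1^-1) d1 * qpoch (q * y2^-1) d2
     * qpoch (q * y1^-1 * y2^-1) d1 * qpoch (q * y1^-1 * y2^-1) d2).

End BaseFields.

Section QuantumGroup.

Variable R : realType.

Definition i1 : 'I_2 := ord0.
Definition i2 : 'I_2 := ord_max.

Inductive generator : Type :=
| GK of 'I_2 | GKinv of 'I_2 | GE of 'I_2 | GF of 'I_2.

Record Uq_relations (t : Cv R) (A : algType (Cv R)) (x : generator -> A) : Prop := {
  rel_KKinv : forall i, x (GK i) * x (GKinv i) = 1;
  rel_KinvK : forall i, x (GKinv i) * x (GK i) = 1;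
  rel_KK : forall i j, x (GK i) * x (GK j) = x (GK j) * x (GK i);
  rel_KE : forall i, x (GK i) * x (GE i) = t ^+ 2 *: (x (GE i) * x (GK i));
  rel_KF : forall i, x (GK i) * x (GF i) = t ^- 2 *: (x (GF i) * x (GK i));
  rel_KE_neq : forall i j, i != j ->
    x (GK i) * x (GE j) = t^-1 *: (x (GE j) * x (GK i));
  rel_KF_neq : forall i j, i != j ->
    x (GK i) * x (GF j) = t *: (x (GF j) * x (GK i));
  rel_EF : forall i,
    x (GE i) * x (GF i) - x (GF i) * x (GE i)
    = (t - t^-1)^-1 *: (x (GK i) - x (GKinv i));
  rel_EF_neq : forall i j, i != j -> x (GE i) * x (GF j) = x (GF j) * x (GE i);
  rel_EEE : forall i j, i != j ->
    x (GE i) ^+ 2 * x (GE j) - (t + t^-1) *: (x (GE i) * x (GE j) * x (GE i))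
    + x (GE j) * x (GE i) ^+ 2 = 0;
  rel_FFF : forall i j, i != j ->
    x (GF i) ^+ 2 * x (GF j) - (t + t^-1) *: (x (GF i) * x (GF j) * x (GF i))
    + x (GF j) * x (GF i) ^+ 2 = 0
}.

(* U_t(sl_3), as an algebra with the presentation [Uq_relations t]: the relations
   hold, the generators generate, and any family satisfying the relations in an
   algebra is the image of the generators under an algebra morphism. *)
Record Uq_sl3 (t : Cv R) : Type := {
  Uq_alg :> algType (Cv R);
  Uq_gen : generator -> Uq_alg;
  Uq_genP : Uq_relations t Uq_gen;
  Uq_generated : forall P : Uq_alg -> Prop,
    P 1 -> (forall g, P (Uq_gen g)) ->
    (forall (c : Cv R) a b, P a -> P b -> P (c *: a + b)) ->
    (forall a b, P a -> P b -> P (a * b)) ->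
    forall a, P a;
  Uq_universal : forall (B : algType (Cv R)) (y : generator -> B),
    Uq_relations t y ->
    exists f : {lrmorphism Uq_alg -> B}, forall g, f (Uq_gen g) = y g
}.

Definition genK (t : Cv R) (U : Uq_sl3 t) (i : 'I_2) : U := Uq_gen U (GK i).
Definition genKinv (t : Cv R) (U : Uq_sl3 t) (i : 'I_2) : U := Uq_gen U (GKinv i).
Definition genE (t : Cv R) (U : Uq_sl3 t) (i : 'I_2) : U := Uq_gen U (GE i).
Definition genF (t : Cv R) (U : Uq_sl3 t) (i : 'I_2) : U := Uq_gen U (GF i).

Record is_sigma (t : Cv R) (U : Uq_sl3 t) (Ubar : Uq_sl3 t^-1)
    (sigma : {lrmorphism U -> Ubar}) : Prop := {
  sigma_bij : bijective sigma;
  sigmaE : forall i, sigma (genE U i) = genE Ubar i;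
  sigmaF : forall i, sigma (genF U i) = genF Ubar i;
  sigmaK : forall i, sigma (genK U i) = genKinv Ubar i
}.

Record is_tau (t : Cv R) (U : Uq_sl3 t) (tau : {linear U -> U}) : Prop := {
  tau_bij : bijective tau;
  tau1 : tau 1 = 1;
  tauM : forall a b, tau (a * b) = tau b * tau a;
  tauE : forall i, tau (genE U i) = genF U i;
  tauF : forall i, tau (genF U i) = genE U i;
  tauK : forall i, tau (genK U i) = genK U i
}.

End QuantumGroup.

Section Verma.

Variables (R : realType) (L : closedFieldType) (iota : {rmorphism Cvl R -> L}).

(* U-modules with scalars extended from C(v) to [sqrt_ring iota] *)
Record Umodule (t : Cv R) (U : Uq_sl3 t) : Type := {
  Umod :> lmodType (sqrt_ring iota);
  act : U -> Umod -> Umod;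
  act_linear : forall a, linear (act a);
  actD : forall a b x, act (a + b) x = act a x + act b x;
  actZ : forall (c : Cv R) a x,
    act (c *: a) x = to_sqrt_ring iota (Cv_to_Cvl c) *: act a x;
  act1 : forall x, act 1 x = x;
  actM : forall a b x, act (a * b) x = act a (act b x)
}.

Definition has_weight (t : Cv R) (U : Uq_sl3 t) (M : Umodule U)
    (a : 'I_2 -> Cvl R) (x : M) : Prop :=
  forall i, act (genK U i) x = to_sqrt_ring iota (a i) *: x.

Definition is_highest_weight (t : Cv R) (U : Uq_sl3 t) (M : Umodule U)
    (a : 'I_2 -> Cvl R) (x : M) : Prop :=
  has_weight a x /\ (forall i, act (genE U i) x = 0).

(* The module generated by a vector with the relations K_i w = a_i w, E_i w = 0,
   presented in the same way as [Uq_sl3]. *)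
Record Verma (t : Cv R) (U : Uq_sl3 t) (a : 'I_2 -> Cvl R) : Type := {
  Verma_mod :> Umodule U;
  Verma_vec : Verma_mod;
  Verma_vecP : is_highest_weight a Verma_vec;
  Verma_generated : forall P : Verma_mod -> Prop,
    P Verma_vec ->
    (forall (c : sqrt_ring iota) x y, P x -> P y -> P (c *: x + y)) ->
    (forall (u : U) x, P x -> P (act u x)) ->
    forall x, P x;
  Verma_universal : forall (M : Umodule U) (m : M),
    is_highest_weight a m ->
    exists f : {linear Verma_mod -> M},
      (forall (u : U) x, f (act u x) = act u (f x)) /\ f Verma_vec = m
}.

(* v^(lambda_1 - lambda_2) and v^(lambda_2 - lambda_3) *)
Definition hwt (i : 'I_2) : Cvl R :=
  if i == i1 then vlam1 R / vlam2 R else vlam2 R / vlam3 R.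

Definition wt (d1 d2 : nat) (i : 'I_2) : Cvl R :=
  if i == i1 then hwt i1 * v R ^ (d2%:Z - (2 * d1)%:Z)
  else hwt i2 * v R ^ (d1%:Z - (2 * d2)%:Z).

Definition hwt_bar (i : 'I_2) : Cvl R := (hwt i)^-1.
Definition wt_bar (d1 d2 : nat) (i : 'I_2) : Cvl R := (wt d1 d2 i)^-1.

(* f (d1 - 1) d2 and f d1 (d2 - 1), terms with a negative index being zero *)
Definition lower1 (M : zmodType) (f : nat -> nat -> M) (d1 d2 : nat) : M :=
  if d1 is d.+1 then f d d2 else 0.
Definition lower2 (M : zmodType) (f : nat -> nat -> M) (d1 d2 : nat) : M :=
  if d2 is d.+1 then f d1 d else 0.

Record is_Whittaker (U : Uq_sl3 (v0 R)) (V : Verma U hwt)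
    (omega : nat -> nat -> V) : Prop := {
  Whittaker_wt : forall d1 d2, has_weight (wt d1 d2) (omega d1 d2);
  Whittaker00 : omega 0%N 0%N = Verma_vec V;
  Whittaker1 : forall d1 d2,
    act (genE U i1 * genKinv U i1) (omega d1 d2)
    = to_sqrt_ring iota (1 - v R ^+ 2)^-1 *: lower1 omega d1 d2;
  Whittaker2 : forall d1 d2,
    act (genE U i2) (omega d1 d2)
    = to_sqrt_ring iota (1 - v R ^+ 2)^-1 *: lower2 omega d1 d2
}.

Record is_dual_Whittaker (Ubar : Uq_sl3 (v0 R)^-1) (Vbar : Verma Ubar hwt_bar)
    (omegabar : nat -> nat -> Vbar) : Prop := {
  dual_Whittaker_wt : forall d1 d2, has_weight (wt_bar d1 d2) (omegabar d1 d2);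
  dual_Whittaker00 : omegabar 0%N 0%N = Verma_vec Vbar;
  dual_Whittaker1 : forall d1 d2,
    act (genE Ubar i1) (omegabar d1 d2)
    = to_sqrt_ring iota (v R / (1 - v R ^- 2)) *: lower1 omegabar d1 d2;
  dual_Whittaker2 : forall d1 d2,
    act (genE Ubar i2 * genK Ubar i2) (omegabar d1 d2)
    = to_sqrt_ring iota (v R / (1 - v R ^- 2)) *: lower2 omegabar d1 d2
}.

Record is_Verma_pairing (U : Uq_sl3 (v0 R)) (Ubar : Uq_sl3 (v0 R)^-1)
    (sigma : {lrmorphism U -> Ubar}) (tau : {linear U -> U})
    (V : Verma U hwt) (Vbar : Verma Ubar hwt_bar)
    (pair : V -> Vbar -> sqrt_ring iota) : Prop := {
  pair_linearl : forall y, scalar (pair^~ y);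
  pair_linearr : forall x, scalar (pair x);
  pair_nondegl : forall x, (forall y, pair x y = 0) -> x = 0;
  pair_nondegr : forall y, (forall x, pair x y = 0) -> y = 0;
  pair_vec : pair (Verma_vec V) (Verma_vec Vbar) = 1;
  pair_act : forall (g : U) x y, pair (act g x) y = pair x (act (sigma (tau g)) y)
}.

End Verma.

(* Main.v *)
Require Import Defs.
From HB Require Import structures.
From mathcomp Require Import all_boot all_order all_algebra.
From mathcomp Require Import complex mpoly.
From mathcomp Require Import boolp reals.
From mathcomp Require Import ring zify.

Set Implicit Arguments.
Unset Strict Implicit.
Unset Printing Implicit Defensive.

Import GRing.Theory.

Local Open Scope ring_scope.


(** The idea is to show that both sides satisfy one and the same recursion of
    q-Toda type, which has a unique solution with value [1] at [(0,0)].

    On the side of the Verma modules the recursion comes from the quadratic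
    Casimir element. It acts by a scalar on the Verma module, and on the
    Whittaker vector each [E_i] is a shift of indices, so that
    [casimir_gap * omega_(d1,d2)] is a combination of [F1 omega_(d1-1,d2)],
    [F2 omega_(d1,d2-1)] and a q-commutator of [F1] and [F2] applied to
    [omega_(d1-1,d2-1)]. The relation ([descent]) is proved without the
    Casimir element, which involves fractional powers of the [K_i]: by
    induction on the indices the difference of its two sides is killed by
    [E_1] and [E_2] ([descent_E1], [descent_E2]), and a vector with this
    property and a weight other than the highest is zero because the pairing
    is non-degenerate ([singular_eq0]).

    Pairing the relation with [omegabar_(d1,d2)] moves each [F_i] to an [E_i]
    acting on the dual Whittaker vector. Among the possible forms of the
    Casimir element the one used here contains the q-commutator whose transpose
    kills the dual Whittaker vector, so that only the neighbours [(d1-1,d2)]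
    and [(d1,d2-1)] remain ([whittaker_pairing_toda]).

    The closed formula satisfies the same recursion because its ratios at
    neighbouring indices are explicit products of linear factors ([Iz_toda]).
    The coefficient [casimir_gap] is nonzero away from [(0,0)], as [1], [y1],
    [y2] and [y1 * y2] are linearly independent over [C(v)] ([y_free]), and
    the two solutions agree. *)

(** * Rational function identities *)

Section Algebra.

Variable K : fieldType.

Lemma divf_mul_divf (a b c : K) : a / b * c / b = a * (c / (b * b)).
Proof. by rewrite invfM; ring. Qed.

Lemma weight_own_shift (v a X Y : K) : v != 0 ->
  a * (Y / (v * X) ^+ 2) * v ^+ 2 = a * (Y / X ^+ 2).
Proof.
move=> nv; rewrite exprMn [v ^+ 2 * _]mulrC invfM [Y * _]mulrA [a * _]mulrA.
by rewrite mulfVK ?expf_neq0.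
Qed.

Lemma weight_other_shift (v a X Y : K) : v != 0 ->
  a * (v * Y / X ^+ 2) / v = a * (Y / X ^+ 2).
Proof.
by move=> nv; rewrite -[v * Y / _]mulrA [v * _]mulrC [a * (_ * v)]mulrA mulfK.
Qed.

Lemma weight_fixed_eq (a X Y : K) : a != 0 -> X != 0 ->
  a * (Y / X ^+ 2) = a -> Y = X ^+ 2.
Proof.
move=> na nX; rewrite -[RHS]mulr1 => /(mulfI na) YX.
by rewrite -[LHS](mulfVK (expf_neq0 2 nX)) YX mul1r.
Qed.

(** With [X = v^d1], [Y = v^d2] and [a1], [a2] the highest weight, this is
    [v^(3-lambda1) / (v^2-1)] times the sum over [i = 1,2,3] of
    [q^(-(mu+rho)_i) - q^(-(lambda+rho)_i)], where [mu] is the weight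
    [lambda - d1 alpha1 - d2 alpha2] and [rho = (1,0,-1)]: the amount by which
    the Cartan part of the quadratic Casimir element varies between the weight
    spaces of [w] and of [omega_(d1,d2)]. *)
Definition casimir_gap (v a1 a2 X Y : K) : K :=
  (v ^+ 3 / a2 * (Y ^+ 2 / X ^+ 2 - 1) + v / (a2 * a1 ^+ 2) * (X ^+ 2 - 1)
   + v ^+ 5 * a2 * (Y ^- 2 - 1)) / (v ^+ 2 - 1).

Lemma casimir_gap_one (v a1 a2 : K) : casimir_gap v a1 a2 1 1 = 0.
Proof.
by rewrite /casimir_gap !expr1n invr1 mulr1 subrr !mulr0 !addr0 mul0r.
Qed.

(** The closed formula enters only through the two ratios of its
    values at [(d1-1,d2)] and [(d1,d2-1)] to the one at [(d1,d2)]: after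
    multiplication by their common denominator the recursion is an identity
    of rational functions in [v], [a1], [a2], [X], [Y]. *)
Lemma toda_of_ratios (v a1 a2 X Y J J1 J2 : K) :
  let q := v ^+ 2 in let y1 := a1 ^- 2 in let y2 := a2 ^- 2 in
  let p := y1 * y2 / q in let eta := v / (1 - v ^- 2) in
  v != 0 -> a1 != 0 -> a2 != 0 -> X != 0 -> Y != 0 -> v ^+ 2 - 1 != 0 ->
  1 - p * (X ^+ 2 * Y ^+ 2) / q != 0 ->
  (1 - p * (X ^+ 2 * Y ^+ 2) / q) * J1
    = (1 - X ^+ 2) * (1 - y1 * X ^+ 2 / q) * (1 - p * X ^+ 2 / q) * J ->
  (1 - p * (X ^+ 2 * Y ^+ 2) / q) * J2
    = (1 - Y ^+ 2) * (1 - y2 * Y ^+ 2 / q) * (1 - p * Y ^+ 2 / q) * J ->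
  casimir_gap v a1 a2 X Y * J
    = Y ^+ 2 / (a2 * X ^+ 2) * eta * J1 + v ^+ 2 * a2 / Y ^+ 2 * eta * J2.
Proof.
move=> q y1 y2 p eta nv na1 na2 nX nY nv2 nD H1 H2.
apply: (mulfI nD); rewrite [RHS]mulrDr [X in _ = X + _]mulrCA H1.
rewrite [X in _ = _ + X]mulrCA H2 /casimir_gap /eta /p /y1 /y2 /q.
by field; rewrite nv na1 na2 nX nY nv2.
Qed.

(** The two equations come from pairing a descent relation with
    [omegabar_(d1,d2)], where [w] is the eigenvalue of [K2] on
    [omega_(d1,d2)]. The second one says that the pairing does not see the
    quadratic terms: the relation contains the q-commutator
    [F1 F2 - v^-1 F2 F1], whose transpose kills the dual Whittaker vector
    because [w] enters the dual equation for [E2] and is multiplied by [v^-1]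
    when [d1] is lowered. *)
Lemma pairing_coefficients (v w a2 X Y eta : K) :
  v != 0 -> X != 0 -> Y != 0 -> w = a2 * (X / Y ^+ 2) ->
  v ^+ 2 / X * (w * eta) = v ^+ 2 * a2 / Y ^+ 2 * eta
  /\ - X^-1 * (eta * (w / v * eta)) + (v * X)^-1 * (w * eta * eta) = 0.
Proof.
by move=> nv nX nY ->; split; field; rewrite ?nv ?nX ?nY.
Qed.

(** Here [x = q^d] for the index [d] that is raised, and [N] and [a] to [f]
    stand for the q-Pochhammer symbols at the lower index. *)
Lemma pochhammer_ratio (q x y y1 p N a b c d e f : K) :
  q != 0 -> a != 0 -> b != 0 -> c != 0 -> d != 0 -> e != 0 -> f != 0 ->
  1 - q * x != 0 -> 1 - y1 * x != 0 -> 1 - p * x != 0 ->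
  (1 - p * (q * x * y) / q) * (N / (a * b * c * d * e * f))
  = (1 - q * x) * (1 - y1 * (q * x) / q) * (1 - p * (q * x) / q)
    * ((N * (1 - p * (x * y)))
       / ((a * (1 - q * x)) * b * (c * (1 - y1 * x)) * d * (e * (1 - p * x))
          * f)).
Proof.
move=> n1 n2 n3 n4 n5 n6 n7 n8 n9 n10.
by field; rewrite n1 n2 n3 n4 n5 n6 n7 n8 n9 n10.
Qed.

Section FreeBasis.

Variables (k : fieldType) (emb : {rmorphism k -> K}) (y1 y2 : K).
Hypothesis y_free : forall c0 c1 c2 c3 : k,
  emb c0 + emb c1 * y1 + emb c2 * y2 + emb c3 * (y1 * y2) = 0 ->
  [/\ c0 = 0, c1 = 0, c2 = 0 & c3 = 0].

Lemma factors_neq0 c : [/\ 1 - y1 * emb c != 0, 1 - y2 * emb c != 0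
  & 1 - y1 * y2 * emb c != 0].
Proof.
have n1 : (1 : k) != 0 by rewrite oner_eq0.
split; apply: contraNneq n1 => y_c; apply/eqP.
- have [|//] := @y_free 1 (- c) 0 0.
  by rewrite rmorph1 rmorphN rmorph0 -[RHS]y_c; ring.
- have [|//] := @y_free 1 0 (- c) 0.
  by rewrite rmorph1 rmorphN rmorph0 -[RHS]y_c; ring.
- have [|//] := @y_free 1 0 0 (- c).
  by rewrite rmorph1 rmorphN rmorph0 -[RHS]y_c; ring.
Qed.

(** Up to the factor [a2 / (v^2-1)] the gap is a combination of [1],
    [y2] and [y1 * y2] with coefficients in the small field, and the
    coefficients of [1] and [y1 * y2] cannot vanish together. *)
Lemma casimir_gap_neq0 (t X Y : k) (a1 a2 : K) :
  y1 = a1 ^- 2 -> y2 = a2 ^- 2 -> a1 != 0 -> a2 != 0 ->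
  t != 0 -> X != 0 -> Y != 0 -> t ^+ 2 - 1 != 0 ->
  (X ^+ 2 != 1) || (Y ^+ 2 != 1) ->
  casimir_gap (emb t) a1 a2 (emb X) (emb Y) != 0.
Proof.
move=> Ey1 Ey2 na1 na2 nt nX nY nt2; apply: contraTneq => gap0.
have ntE : emb t ^+ 2 - 1 != 0.
  by rewrite -rmorphXn -(rmorph1 emb) -rmorphB fmorph_eq0.
have nXE : emb X != 0 by rewrite fmorph_eq0.
have nYE : emb Y != 0 by rewrite fmorph_eq0.
have [] := @y_free (t ^+ 5 * (Y ^- 2 - 1)) 0 (t ^+ 3 * (Y ^+ 2 / X ^+ 2 - 1))
  (t * (X ^+ 2 - 1)).
  rewrite !(rmorphM, rmorphB, rmorphXn, rmorph1, rmorph0, fmorphV) Ey1 Ey2.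
  transitivity (casimir_gap (emb t) a1 a2 (emb X) (emb Y)
                * (emb t ^+ 2 - 1) / a2).
    by rewrite /casimir_gap; field; rewrite nXE nYE na1 na2 ntE.
  by rewrite gap0 !mul0r.
move=> /eqP; rewrite mulf_eq0 expf_eq0 (negPf nt) /= subr_eq0 invr_eq1.
move=> /eqP -> _ _ /eqP; rewrite mulf_eq0 (negPf nt) /= subr_eq0 => /eqP ->.
by rewrite !eqxx.
Qed.

End FreeBasis.

Variables (S : comNzRingType) (phi : {rmorphism K -> S}) (M : lmodType S).
Local Notation "c \: x" := (phi c *: x) (at level 40, left associativity).

Lemma combine_coefficients (c1 c2 c3 c4 e1 e2 e3 e4 b : K) (p1 p2 p : S) :
  c2 * e2 = b -> c3 * e3 + c4 * e4 = 0 ->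
  phi c1 * (phi e1 * p1) + phi c2 * (phi e2 * p2) + phi c3 * (phi e3 * p)
    + phi c4 * (phi e4 * p) = phi (c1 * e1) * p1 + phi b * p2.
Proof.
move=> <- cancel; rewrite !mulrA -!rmorphM -[LHS]addrA -mulrDl -rmorphD cancel.
by rewrite rmorph0 mul0r addr0.
Qed.

Lemma rmorph_combination (c1 c2 x1 x2 : K) :
  phi (c1 * x1 + c2 * x2) = phi c1 * phi x1 + phi c2 * phi x2.
Proof. by rewrite rmorphD !rmorphM. Qed.

Definition qbracket (v k : K) := (v - v^-1)^-1 * (k - k^-1).

(** The effect of [E1] on the descent relation (see [descent] below). A name
    such as [F12x112] stands for [F1 F2] applied to the Whittaker component
    lowered twice in the first and once in the second index, and the
    hypotheses on [E1F1] to [E1F21] are what the commutation relations give. The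
    contributions to [F2x12] cancel against those of the relation at
    [(d1-1,d2)], and the change of [casimir_gap] absorbs the Cartan term of
    [E1 F1]. *)
Lemma raise1_descent (v a1 a2 X Y k1 : K)
    (E1w E1F1 E1F2 E1F12 E1F21 x1 F1x11 F2x12 F12x112 F21x112 : M) :
  let eps := (1 - v ^+ 2)^-1 in
  v != 0 -> a1 != 0 -> a2 != 0 -> X != 0 -> Y != 0 -> v ^+ 2 - 1 != 0 ->
  k1 = a1 * Y / X ^+ 2 ->
  E1w = eps * k1 \: x1 ->
  E1F1 = eps * (k1 * v ^+ 2) \: F1x11 + qbracket v (k1 * v ^+ 2) \: x1 ->
  E1F2 = eps * (k1 / v) \: F2x12 ->
  E1F12 = eps * (k1 * v) \: F12x112 + qbracket v (k1 * v ^+ 2) \: F2x12 ->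
  E1F21 = eps * (k1 * v) \: F21x112 + qbracket v (k1 * v) \: F2x12 ->
  casimir_gap v a1 a2 (X / v) Y \: x1 = Y ^+ 2 / (a2 * (X / v) ^+ 2) \: F1x11
    + v ^+ 2 / (X / v) \: F2x12 + (- (X / v)^-1) \: F12x112
    + (v * (X / v))^-1 \: F21x112 ->
  casimir_gap v a1 a2 X Y \: E1w = Y ^+ 2 / (a2 * X ^+ 2) \: E1F1
    + v ^+ 2 / X \: E1F2 + (- X^-1) \: E1F12 + (v * X)^-1 \: E1F21.
Proof.
move=> eps nv na1 na2 nX nY nv2 Ek -> -> -> -> -> IH.
pose s' := casimir_gap v a1 a2 (X / v) Y.
(* splits off the multiple of x1 to which the lower relation applies *)
have -> : casimir_gap v a1 a2 X Y \: (eps * k1 \: x1)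
   = eps * k1 \: (s' \: x1) + (casimir_gap v a1 a2 X Y - s') * (eps * k1) \: x1.
  by rewrite !scalerA -!rmorphM -scalerDl -rmorphD; congr (phi _ *: _); ring.
have nv2' : 1 - v ^+ 2 != 0 by rewrite -opprB oppr_eq0.
rewrite IH !scalerDr !scalerA -!rmorphM !addrA.
(* collects the terms in F1x11, F2x12, F12x112, F21x112 and x1 *)
rewrite [RHS](ACl (1*(3*5*7)*4*6*2))%AC /= -!scalerDl -!rmorphD.
rewrite /s' /casimir_gap /qbracket /eps Ek.
by congr (phi _ *: _ + phi _ *: _ + phi _ *: _ + phi _ *: _ + phi _ *: _);
  field; rewrite ?nv ?na1 ?na2 ?nX ?nY ?nv2 ?nv2'.
Qed.

(** The effect of [E2], in the same notation; here the terms that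
    recombine are those in [F1x12]. *)
Lemma raise2_descent (v a1 a2 X Y k2 : K)
    (E2w E2F1 E2F2 E2F12 E2F21 x2 F1x12 F2x22 F12x122 F21x122 : M) :
  let eps := (1 - v ^+ 2)^-1 in
  v != 0 -> a1 != 0 -> a2 != 0 -> X != 0 -> Y != 0 -> v ^+ 2 - 1 != 0 ->
  k2 = a2 * X / Y ^+ 2 ->
  E2w = eps \: x2 ->
  E2F1 = eps \: F1x12 ->
  E2F2 = eps \: F2x22 + qbracket v (k2 * v ^+ 2) \: x2 ->
  E2F12 = eps \: F12x122 + qbracket v (k2 * v) \: F1x12 ->
  E2F21 = eps \: F21x122 + qbracket v (k2 * v ^+ 2) \: F1x12 ->
  casimir_gap v a1 a2 X (Y / v) \: x2 = (Y / v) ^+ 2 / (a2 * X ^+ 2) \: F1x12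
    + v ^+ 2 / X \: F2x22 + (- X^-1) \: F12x122 + (v * X)^-1 \: F21x122 ->
  casimir_gap v a1 a2 X Y \: E2w = Y ^+ 2 / (a2 * X ^+ 2) \: E2F1
    + v ^+ 2 / X \: E2F2 + (- X^-1) \: E2F12 + (v * X)^-1 \: E2F21.
Proof.
move=> eps nv na1 na2 nX nY nv2 Ek -> -> -> -> -> IH.
pose s' := casimir_gap v a1 a2 X (Y / v).
have -> : casimir_gap v a1 a2 X Y \: (eps \: x2)
   = eps \: (s' \: x2) + (casimir_gap v a1 a2 X Y - s') * eps \: x2.
  by rewrite !scalerA -!rmorphM -scalerDl -rmorphD; congr (phi _ *: _); ring.
have nv2' : 1 - v ^+ 2 != 0 by rewrite -opprB oppr_eq0.
rewrite IH !scalerDr !scalerA -!rmorphM !addrA.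
(* collects the terms in F1x12, F2x22, F12x122, F21x122 and x2 *)
rewrite [RHS](ACl ((1*5*7)*2*4*6*3))%AC /= -!scalerDl -!rmorphD.
rewrite /s' /casimir_gap /qbracket /eps Ek.
by congr (phi _ *: _ + phi _ *: _ + phi _ *: _ + phi _ *: _ + phi _ *: _);
  field; rewrite ?nv ?na1 ?na2 ?nX ?nY ?nv2 ?nv2'.
Qed.

End Algebra.

(** * The base field *)

(** Multiplication by [x1^4 * x2^4] is the least that turns the four
    terms into monomials, since [y2 = x1^-2 * x2^-4] and
    [y1 * y2 = x1^-4 * x2^-2]. *)
Lemma clear_denominators (K : fieldType) (x1 x2 c0 c1 c2 c3 : K) :
  x1 != 0 -> x2 != 0 ->
  let y1 := (x1 / x2) ^- 2 in let y2 := (x2 / (x1 * x2)^-1) ^- 2 in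
  (c0 + c1 * y1 + c2 * y2 + c3 * (y1 * y2)) * (x1 ^+ 4 * x2 ^+ 4)
  = c0 * (x1 ^+ 4 * x2 ^+ 4) + c1 * (x1 ^+ 2 * x2 ^+ 6) + c2 * x1 ^+ 2
    + c3 * x2 ^+ 2.
Proof. by move=> nz1 nz2 /=; field; rewrite nz1 nz2 oner_neq0. Qed.

(** The monomials are those left by [clear_denominators]. *)
Lemma monomials_free (k : fieldType) (c0 c1 c2 c3 : k) :
  let x1 : {mpoly k[2]} := 'X_ord0 in let x2 : {mpoly k[2]} := 'X_ord_max in
  c0%:MP * (x1 ^+ 4 * x2 ^+ 4) + c1%:MP * (x1 ^+ 2 * x2 ^+ 6)
    + c2%:MP * x1 ^+ 2 + c3%:MP * x2 ^+ 2 = 0 ->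
  [/\ c0 = 0, c1 = 0, c2 = 0 & c3 = 0].
Proof.
move=> x1 x2; rewrite /x1 /x2 !mpolyXn -!mpolyXD => /mpolyP H.
have mE (m m' : 'X_{1..2}) i : m i != m' i -> (m == m') = false.
  by move=> neq; apply: contraNF neq => /eqP ->.
split.
- move: (H (U_(ord0) *+ 4 + U_(ord_max) *+ 4)%MM).
  rewrite 3!mcoeffD 4!mcoeffCM 4!mcoeffX mcoeff0 eqxx.
  do 3!rewrite (mE _ _ ord0) ?mnmE //.
  by rewrite !mulr0 mulr1 !addr0.
- move: (H (U_(ord0) *+ 2 + U_(ord_max) *+ 6)%MM).
  rewrite 3!mcoeffD 4!mcoeffCM 4!mcoeffX mcoeff0 eqxx.
  rewrite (mE _ _ ord0) ?mnmE // (mE _ _ ord_max) ?mnmE //.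
  by rewrite (mE _ _ ord0) ?mnmE // !mulr0 mulr1 !addr0 add0r.
- move: (H (U_(ord0) *+ 2)%MM).
  rewrite 3!mcoeffD 4!mcoeffCM 4!mcoeffX mcoeff0 eqxx.
  rewrite (mE _ _ ord0) ?mnmE // (mE _ _ ord_max) ?mnmE //.
  by rewrite (mE _ _ ord0) ?mnmE // !mulr0 mulr1 addr0 !add0r.
- move: (H (U_(ord_max) *+ 2)%MM).
  rewrite 3!mcoeffD 4!mcoeffCM 4!mcoeffX mcoeff0 eqxx.
  do 3!rewrite (mE _ _ ord0) ?mnmE //.
  by rewrite !mulr0 mulr1 !add0r.
Qed.

Section Coefficients.

Variable R : realType.

HB.instance Definition _ := GRing.RMorphism.copy (@Cv_to_Cvl R)
  (@tofrac {mpoly (Cv R)[2]} \o @mpolyC 2 (Cv R)).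

Lemma v_expnE n : v R ^+ n = Cv_to_Cvl (v0 R ^+ n).
Proof. by rewrite rmorphXn. Qed.

Lemma v0_neq0 : v0 R != 0.
Proof. by rewrite tofrac_eq0 polyX_eq0. Qed.

Lemma v_neq0 : v R != 0.
Proof. by rewrite fmorph_eq0 v0_neq0. Qed.

Lemma v0_expn_inj : injective (fun n => v0 R ^+ n).
Proof.
move=> m n /eqP; rewrite /v0 -!rmorphXn tofrac_eq => /eqP.
by move=> /(congr1 (size \o val)) /=; rewrite !size_polyXn => -[].
Qed.

Lemma v_expn_inj : injective (fun n => v R ^+ n).
Proof. by move=> m n /=; rewrite !v_expnE => /fmorph_inj /v0_expn_inj. Qed.

Lemma v0_expn_eq1 n : (v0 R ^+ n == 1) = (n == 0)%N.
Proof. by rewrite -(expr0 (v0 R)) (inj_eq v0_expn_inj). Qed.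

Lemma v_expn_eq1 n : (v R ^+ n == 1) = (n == 0)%N.
Proof. by rewrite -(expr0 (v R)) (inj_eq v_expn_inj). Qed.

Lemma v2B1_neq0 : v R ^+ 2 - 1 != 0.
Proof. by rewrite subr_eq0 v_expn_eq1. Qed.

(** These are [q / z1] and [q / z2], the arguments of the
    q-Pochhammer symbols; the powers [v^lambda_i] occur in the closed formula
    only through them. *)
Definition y1 : Cvl R := (vlam1 R / vlam2 R) ^- 2.
Definition y2 : Cvl R := (vlam2 R / vlam3 R) ^- 2.

Lemma vlam1_neq0 : vlam1 R != 0.
Proof. by rewrite tofrac_eq0 -msupp_eq0 msuppX. Qed.

Lemma vlam2_neq0 : vlam2 R != 0.
Proof. by rewrite tofrac_eq0 -msupp_eq0 msuppX. Qed.

Lemma y_free (c0 c1 c2 c3 : Cv R) :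
  let emb := @Cv_to_Cvl R in
  emb c0 + emb c1 * y1 + emb c2 * y2 + emb c3 * (y1 * y2) = 0 ->
  [/\ c0 = 0, c1 = 0, c2 = 0 & c3 = 0].
Proof.
move=> emb; rewrite /y1 /y2 /vlam3 => H.
have nz1 := vlam1_neq0; have nz2 := vlam2_neq0.
have {H} : emb c0 * (vlam1 R ^+ 4 * vlam2 R ^+ 4)
    + emb c1 * (vlam1 R ^+ 2 * vlam2 R ^+ 6)
    + emb c2 * vlam1 R ^+ 2 + emb c3 * vlam2 R ^+ 2 = 0.
  by rewrite -clear_denominators // H mul0r.
rewrite /emb /Cv_to_Cvl /vlam1 /vlam2 -!rmorphXn -!rmorphM -!rmorphD /=.
move/eqP; rewrite tofrac_eq0 => /eqP.
exact: monomials_free.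
Qed.

End Coefficients.

(** * The closed formula and its recursion *)

Section ClosedFormula.

Variable R : realType.

Local Notation q := (q R).
Local Notation y1 := (y1 R).
Local Notation y2 := (y2 R).

Lemma q_neq0 : q != 0.
Proof. by rewrite expf_neq0 // v_neq0. Qed.

Lemma q_z1 : q * (z1 R)^-1 = y1.
Proof. by rewrite /z1 invfM mulrCA mulfV ?q_neq0 // mulr1. Qed.

Lemma q_z2 : q * (z2 R)^-1 = y2.
Proof. by rewrite /z2 invfM mulrCA mulfV ?q_neq0 // mulr1. Qed.

Lemma q_z1z2 : q * (z1 R)^-1 * (z2 R)^-1 = y1 * y2 / q.
Proof. by rewrite q_z1 -q_z2 -mulrA [q * _]mulrC mulfK ?q_neq0. Qed.

Lemma qpochS (a : Cvl R) n : qpoch a n.+1 = qpoch a n * (1 - a * q ^+ n).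
Proof. by rewrite /qpoch big_ord_recr. Qed.

Lemma qpoch_neq0 (a : Cvl R) n :
  (forall k, 1 - a * q ^+ k != 0) -> qpoch a n != 0.
Proof. by move=> a_ok; apply/prodf_neq0 => i _; apply: a_ok. Qed.

Lemma q_factor_neq0 k : 1 - q * q ^+ k != 0.
Proof. by rewrite -exprS -exprM subr_eq0 eq_sym v_expn_eq1. Qed.

Lemma vexpE n : v R ^ n = Cv_to_Cvl (v0 R ^ n).
Proof. by rewrite fmorphXz. Qed.

Lemma y1_factor_neq0 n : 1 - y1 * v R ^ n != 0.
Proof.
rewrite vexpE.
case: (factors_neq0 (@y_free R) (v0 R ^ n)) => h _ _; exact: h.
Qed.

Lemma y2_factor_neq0 n : 1 - y2 * v R ^ n != 0.
Proof.
rewrite vexpE.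
case: (factors_neq0 (@y_free R) (v0 R ^ n)) => _ h _; exact: h.
Qed.

Lemma y1y2_factor_neq0 n : 1 - y1 * y2 * v R ^ n != 0.
Proof.
rewrite vexpE.
case: (factors_neq0 (@y_free R) (v0 R ^ n)) => _ _ h; exact: h.
Qed.

Lemma qXE n : q ^+ n = v R ^ (n * 2)%:Z.
Proof. by rewrite -exprM mulnC. Qed.

Lemma qXVE n : q ^+ n / q = v R ^ ((n * 2)%:Z - 2%:Z).
Proof. by rewrite expfzDr ?v_neq0 // -qXE. Qed.

Lemma p_factor_neq0 k : 1 - y1 * y2 / q * q ^+ k != 0.
Proof. by rewrite mulrAC -mulrA qXVE y1y2_factor_neq0. Qed.

Lemma Ifun00 (w1 w2 : Cvl R) : Ifun 0 0 w1 w2 = 1.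
Proof. by rewrite /Ifun /qpoch !big_ord0 !mulr1 invr1 mulr1. Qed.

Lemma Ifun_sym d1 d2 (w1 w2 : Cvl R) : Ifun d1 d2 w1 w2 = Ifun d2 d1 w2 w1.
Proof.
rewrite /Ifun addnC [q / w1 / w2]mulrAC; congr (_ / _).
by rewrite (ACl (2*1*4*3*6*5))%AC.
Qed.

(** Reading off the last factor of each q-Pochhammer symbol gives the ratio
    for [d1 > 0]; for [d1 = 0] both sides vanish, by the convention on
    negative indices and the factor [1 - q^0]. *)
Lemma Ifun_lower1 (w1 w2 : Cvl R) d1 d2 :
  (forall k, 1 - q * w1^-1 * q ^+ k != 0) ->
  (forall k, 1 - q * w2^-1 * q ^+ k != 0) ->
  (forall k, 1 - q * w1^-1 * w2^-1 * q ^+ k != 0) ->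
  let p := q * w1^-1 * w2^-1 in
  (1 - p * (q ^+ d1 * q ^+ d2) / q)
    * lower1 (fun e1 e2 => Ifun e1 e2 w1 w2) d1 d2
  = (1 - q ^+ d1) * (1 - q * w1^-1 * q ^+ d1 / q) * (1 - p * q ^+ d1 / q)
    * Ifun d1 d2 w1 w2.
Proof.
move=> nw1 nw2 np p; case: d1 => [|d1] /=.
  by rewrite expr0 subrr mulr0 !mul0r.
rewrite /Ifun addSn !qpochS !exprS exprD.
apply: pochhammer_ratio.
- exact: q_neq0.
- exact/qpoch_neq0/q_factor_neq0.
- exact/qpoch_neq0/q_factor_neq0.
- exact: qpoch_neq0.
- exact: qpoch_neq0.
- exact: qpoch_neq0.
- exact: qpoch_neq0.
- exact: q_factor_neq0.
- exact: nw1.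
- exact: np.
Qed.

Lemma Ifun_lower2 (w1 w2 : Cvl R) d1 d2 :
  (forall k, 1 - q * w1^-1 * q ^+ k != 0) ->
  (forall k, 1 - q * w2^-1 * q ^+ k != 0) ->
  (forall k, 1 - q * w1^-1 * w2^-1 * q ^+ k != 0) ->
  let p := q * w1^-1 * w2^-1 in
  (1 - p * (q ^+ d1 * q ^+ d2) / q)
    * lower2 (fun e1 e2 => Ifun e1 e2 w1 w2) d1 d2
  = (1 - q ^+ d2) * (1 - q * w2^-1 * q ^+ d2 / q) * (1 - p * q ^+ d2 / q)
    * Ifun d1 d2 w1 w2.
Proof.
move=> nw1 nw2 np p.
have np' k : 1 - q * w2^-1 * w1^-1 * q ^+ k != 0.
  by rewrite [q / w2 / w1]mulrAC; apply: np.
have -> : lower2 (fun e1 e2 => Ifun e1 e2 w1 w2) d1 d2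
    = lower1 (fun e1 e2 => Ifun e1 e2 w2 w1) d2 d1.
  by case: d2 => //= d2; apply: Ifun_sym.
rewrite [q ^+ d1 * _]mulrC Ifun_sym /p [q / w1 / w2]mulrAC.
exact: (Ifun_lower1 d2 d1 nw2 nw1 np').
Qed.

Definition Iz d1 d2 : Cvl R := Ifun d1 d2 (z1 R) (z2 R).

Local Notation a1 := (vlam1 R / vlam2 R).
Local Notation a2 := (vlam2 R / vlam3 R).

Lemma a1_neq0 : a1 != 0.
Proof. by rewrite mulf_neq0 ?invr_neq0 ?vlam1_neq0 ?vlam2_neq0. Qed.

Lemma a2_neq0 : a2 != 0.
Proof.
by rewrite mulf_neq0 ?invr_neq0 ?mulf_neq0 ?vlam1_neq0 ?vlam2_neq0.
Qed.

(** The recursion of Toda type which, together with the value [1] at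
    [(0,0)], determines the closed formula. *)
Lemma Iz_toda d1 d2 :
  let X := v R ^+ d1 in let Y := v R ^+ d2 in
  let eta := v R / (1 - v R ^- 2) in
  casimir_gap (v R) a1 a2 X Y * Iz d1 d2
  = Y ^+ 2 / (a2 * X ^+ 2) * eta * lower1 Iz d1 d2
    + v R ^+ 2 * a2 / Y ^+ 2 * eta * lower2 Iz d1 d2.
Proof.
move=> X Y eta.
have nf1 k : 1 - q * (z1 R)^-1 * q ^+ k != 0.
  by rewrite q_z1 qXE y1_factor_neq0.
have nf2 k : 1 - q * (z2 R)^-1 * q ^+ k != 0.
  by rewrite q_z2 qXE y2_factor_neq0.
have nfp k : 1 - q * (z1 R)^-1 * (z2 R)^-1 * q ^+ k != 0.
  by rewrite q_z1z2 p_factor_neq0.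
have qX n : q ^+ n = (v R ^+ n) ^+ 2 by rewrite exprAC.
have H1 := Ifun_lower1 d1 d2 nf1 nf2 nfp.
have H2 := Ifun_lower2 d1 d2 nf1 nf2 nfp.
rewrite !q_z1z2 ?q_z1 ?q_z2 !qX in H1 H2.
have nX : X != 0 by apply/expf_neq0/v_neq0.
have nY : Y != 0 by apply/expf_neq0/v_neq0.
have nD : 1 - y1 * y2 / q * (X ^+ 2 * Y ^+ 2) / q != 0.
  rewrite -!qX -exprD divf_mul_divf.
  have -> : q ^+ (d1 + d2) / (q * q) = v R ^ (((d1 + d2) * 2)%:Z - 4%:Z).
    by rewrite expfzDr ?v_neq0 // -qXE -exprD.
  exact: y1y2_factor_neq0.
exact: (@toda_of_ratios _ (v R) a1 a2 X Y (Iz d1 d2) (lower1 Iz d1 d2)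
  (lower2 Iz d1 d2) (v_neq0 R) a1_neq0 a2_neq0 nX nY (v2B1_neq0 R) nD H1 H2).
Qed.

(** This is what makes the recursion determine its solution: the coefficient of
    the new value vanishes at [(0,0)] only. *)
Lemma casimir_gap_weight_neq0 d1 d2 : (d1, d2) != (0, 0)%N ->
  casimir_gap (v R) a1 a2 (v R ^+ d1) (v R ^+ d2) != 0.
Proof.
move=> nd; rewrite [v R ^+ d1]v_expnE [v R ^+ d2]v_expnE.
have nX : v0 R ^+ d1 != 0 by apply/expf_neq0/v0_neq0.
have nY : v0 R ^+ d2 != 0 by apply/expf_neq0/v0_neq0.
have nv2 : v0 R ^+ 2 - 1 != 0 by rewrite subr_eq0 v0_expn_eq1.
have nXY : (v0 R ^+ d1 ^+ 2 != 1) || (v0 R ^+ d2 ^+ 2 != 1).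
  by rewrite -!exprM !v0_expn_eq1 !muln_eq0 !orbF -negb_and.
exact: (casimir_gap_neq0 (@y_free R) erefl erefl a1_neq0 a2_neq0 (v0_neq0 R)
  nX nY nv2 nXY).
Qed.

End ClosedFormula.

(** * Modules, weights and the vanishing of singular vectors *)

Section Modules.

Variables (R : realType) (L : closedFieldType) (iota : {rmorphism Cvl R -> L}).

Local Notation "c \: x" := (to_sqrt_ring iota c *: x)
  (at level 40, left associativity).

HB.instance Definition _ (t : Cv R) (U : Uq_sl3 t) (M : Umodule iota U) (a : U) :=
  GRing.isLinear.Build (sqrt_ring iota) M M *:%R (act a) (act_linear a).

Lemma act0 (t : Cv R) (U : Uq_sl3 t) (M : Umodule iota U) (u : U) :
  act u (0 : M) = 0.
Proof. exact: linear0. Qed.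

Lemma scale_scalarA (M : lmodType (sqrt_ring iota)) b c (x : M) :
  b \: (c \: x) = (b * c) \: x.
Proof. by rewrite scalerA -rmorphM. Qed.

Section Relations.

Variables (t : Cv R) (U : Uq_sl3 t) (M : Umodule iota U).
Implicit Types (x : M) (i j : 'I_2).

Local Notation T := (Cv_to_Cvl t).
Local Notation K i := (act (genK U i)).
Local Notation Ki i := (act (genKinv U i)).
Local Notation E i := (act (genE U i)).
Local Notation F i := (act (genF U i)).

Lemma act_Kinv i (k : Cvl R) x : k != 0 -> K i x = k \: x -> Ki i x = k^-1 \: x.
Proof.
move=> nk Kx; have := act1 x; rewrite -(rel_KinvK (Uq_genP U) i) actM.
rewrite -/(genK U i) -/(genKinv U i) Kx linearZ /= => {2}<-.
by rewrite scale_scalarA mulVf // rmorph1 scale1r.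
Qed.

Lemma act_KF i x (k : Cvl R) j : K i x = k \: x ->
  K i (F j x) = (k * (if i == j then T ^- 2 else T)) \: F j x.
Proof.
move=> Kx; rewrite -actM /genK /genF.
have [<-|nij] := eqVneq i j.
  rewrite (rel_KF (Uq_genP U)) actZ actM -/(genK U i) Kx linearZ /=.
  by rewrite scale_scalarA mulrC fmorphV rmorphXn.
rewrite (rel_KF_neq (Uq_genP U) nij) actZ actM -/(genK U i) Kx linearZ /=.
by rewrite scale_scalarA mulrC.
Qed.

Lemma act_EF i (k : Cvl R) x : k != 0 -> K i x = k \: x ->
  E i (F i x) = F i (E i x) + qbracket T k \: x.
Proof.
move=> nk Kx; apply/eqP; rewrite addrC -subr_eq -!actM.
have actB (a b : U) y : act (a - b) y = act a y - act b y :> M.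
  have N1 : to_sqrt_ring iota (Cv_to_Cvl (-1)) = -1.
    exact: (rmorphN1 (to_sqrt_ring iota \o @Cv_to_Cvl R)).
  by rewrite actD -[- b]scaleN1r actZ N1 scaleN1r.
rewrite -actB /genE /genF (rel_EF (Uq_genP U)) actZ actB.
rewrite -/(genK U i) -/(genKinv U i) Kx (act_Kinv nk Kx) -scalerBl -rmorphB.
by rewrite scale_scalarA /qbracket fmorphV rmorphB fmorphV.
Qed.

Lemma act_EF_neq i j x : i != j -> E i (F j x) = F j (E i x).
Proof. by move=> nij; rewrite -!actM /genE /genF (rel_EF_neq (Uq_genP U)). Qed.

Lemma act_E_EKinv i x (k : Cvl R) : k != 0 -> K i x = k \: x ->
  E i x = k \: act (genE U i * genKinv U i) x.
Proof.
move=> nk Kx; rewrite actM (act_Kinv nk Kx) linearZ /= scale_scalarA mulfV //.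
by rewrite rmorph1 scale1r.
Qed.

End Relations.

Section Lowering.

Variables (t : Cv R) (U : Uq_sl3 t) (M : Umodule iota U).
Hypothesis t_neq0 : t != 0.
Variables (a : 'I_2 -> Cvl R) (w : M).
Hypotheses (a_neq0 : forall i, a i != 0) (w_hw : is_highest_weight a w).

Inductive Fmonomial : M -> Prop :=
| Fmonomial_vec : Fmonomial w
| Fmonomial_act i x : Fmonomial x -> Fmonomial (act (genF U i) x).

(** Lists of monomials with coefficients, rather than a closure under sums, so
    that a linear statement is checked on monomials only. Monomials are weight
    vectors, hence [K_i^-1] acts on them by a scalar without any relation
    between [K_i^-1] and [F_j]. *)
Inductive Fspan : M -> Prop :=
| Fspan0 : Fspan 0
| Fspan_lin c x y : Fmonomial x -> Fspan y -> Fspan (c *: x + y).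

Lemma FspanD x y : Fspan x -> Fspan y -> Fspan (x + y).
Proof.
move=> + Fy; elim=> [|c x1 x2 mx1 _ IH]; first by rewrite add0r.
by rewrite -addrA; constructor.
Qed.

Lemma FspanZ c x : Fspan x -> Fspan (c *: x).
Proof.
elim=> [|d x1 x2 mx1 _ IH]; first by rewrite scaler0; constructor.
by rewrite scalerDr scalerA; constructor.
Qed.

Lemma Fspan_monomial x : Fmonomial x -> Fspan x.
Proof.
by move=> mx; rewrite -[x]addr0 -[x]scale1r; constructor => //; constructor.
Qed.

Lemma Fspan_act_extend (u : U) :
  (forall x, Fmonomial x -> Fspan (act u x)) ->
  forall x, Fspan x -> Fspan (act u x).
Proof.
move=> Hu x; elim=> [|c x1 x2 mx1 _ IH]; first by rewrite linear0; constructor.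
by rewrite linearP /=; apply: FspanD => //; apply/FspanZ/Hu.
Qed.

Lemma Fspan_F i x : Fspan x -> Fspan (act (genF U i) x).
Proof.
by apply: Fspan_act_extend => y my; apply/Fspan_monomial/Fmonomial_act.
Qed.

Lemma Fmonomial_wt x : Fmonomial x ->
  forall i, exists2 k, k != 0 & act (genK U i) x = k \: x.
Proof.
elim=> [|j y _ IH] i; first by exists (a i) => //; case: w_hw.
have [k nk Kk] := IH i.
exists (k * (if i == j then Cv_to_Cvl t ^- 2 else Cv_to_Cvl t)).
  have nT : Cv_to_Cvl t != 0 by rewrite fmorph_eq0.
  apply: (mulf_neq0 nk); case: ifP => _; last exact: nT.
  exact/invr_neq0/expf_neq0.
exact: act_KF.
Qed.

(** [E_i] is moved to the right through the [F_j] until it meets the highest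
    weight vector; each commutator contributes a scalar because monomials are
    weight vectors. *)
Lemma Fmonomial_E i x : Fmonomial x -> Fspan (act (genE U i) x).
Proof.
elim=> [|j y my IH]; first by case: w_hw => _ ->; constructor.
have [<-|nij] := eqVneq i j; last by rewrite act_EF_neq //; apply: Fspan_F.
have [k nk Kk] := Fmonomial_wt my i; rewrite (act_EF nk Kk).
by apply: FspanD; [apply: Fspan_F | apply/FspanZ/Fspan_monomial].
Qed.

Lemma Fspan_act (u : U) x : Fspan x -> Fspan (act u x).
Proof.
move: u x.
apply: (Uq_generated (P := fun u => forall x, Fspan x -> Fspan (act u x))).
- by move=> x; rewrite act1.
- case=> i; apply: Fspan_act_extend => y my.
  + by have [k nk ->] := Fmonomial_wt my i; apply/FspanZ/Fspan_monomial.
  + have [k nk Kk] := Fmonomial_wt my i; rewrite (act_Kinv nk Kk).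
    exact/FspanZ/Fspan_monomial.
  + exact: Fmonomial_E.
  + exact/Fspan_F/Fspan_monomial.
- move=> c u1 u2 H1 H2 x Fx; rewrite actD actZ.
  by apply: FspanD; [apply/FspanZ/H1 | apply: H2].
- by move=> u1 u2 H1 H2 x Fx; rewrite actM; apply/H1/H2.
Qed.

End Lowering.

Lemma Verma_Fspan (t : Cv R) (U : Uq_sl3 t) (a : 'I_2 -> Cvl R)
    (V : Verma iota U a) :
  t != 0 -> (forall i, a i != 0) -> forall x : V, Fspan (Verma_vec V) x.
Proof.
move=> nt na; apply: Verma_generated.
- exact/Fspan_monomial/Fmonomial_vec.
- by move=> c x y Fx Fy; apply/FspanD/Fy/FspanZ.
- by move=> u x Fx; apply: (Fspan_act nt na (Verma_vecP V)).
Qed.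

Lemma lowerC (N : zmodType) (f : nat -> nat -> N) :
  lower1 (lower2 f) = lower2 (lower1 f).
Proof. by apply/funext => -[|d1]; apply/funext => -[|d2]. Qed.

Local Notation vR := (v R).
Local Notation a1 := (vlam1 R / vlam2 R).
Local Notation a2 := (vlam2 R / vlam3 R).

Lemma wt1E d1 d2 : wt R d1 d2 i1 = a1 * (vR ^+ d2 / (vR ^+ d1) ^+ 2).
Proof.
rewrite /wt eqxx /hwt eqxx expfzDr ?v_neq0 // -exprM mulnC.
by rewrite -exprnN.
Qed.

Lemma wt2E d1 d2 : wt R d1 d2 i2 = a2 * (vR ^+ d1 / (vR ^+ d2) ^+ 2).
Proof.
by rewrite /wt /hwt /= expfzDr ?v_neq0 // -exprM mulnC -exprnN.
Qed.

Lemma wt_neq0 d1 d2 i : wt R d1 d2 i != 0.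
Proof.
have nX n : vR ^+ n != 0 by apply/expf_neq0/v_neq0.
have nXY m n : vR ^+ m / vR ^+ n ^+ 2 != 0.
  exact: (mulf_neq0 (nX m) (invr_neq0 (expf_neq0 2 (nX n)))).
have [->|ni] := eqVneq i i1; first by
  rewrite wt1E; apply: (mulf_neq0 (a1_neq0 R) (nXY _ _)).
have -> : i = i2 by apply/val_inj; case: i ni => -[|[|]].
by rewrite wt2E; apply: (mulf_neq0 (a2_neq0 R) (nXY _ _)).
Qed.

(** The next four lemmas say how the eigenvalue of [K_i] changes with one
    index; they follow the Cartan matrix. *)
Lemma wt1S1 d1 d2 : wt R d1.+1 d2 i1 * vR ^+ 2 = wt R d1 d2 i1.
Proof.
rewrite !wt1E [vR ^+ d1.+1]exprS; exact: (weight_own_shift _ _ _ (v_neq0 R)).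
Qed.

Lemma wt1S2 d1 d2 : wt R d1 d2.+1 i1 / vR = wt R d1 d2 i1.
Proof.
rewrite !wt1E [vR ^+ d2.+1]exprS; exact: (weight_other_shift _ _ _ (v_neq0 R)).
Qed.

Lemma wt2S1 d1 d2 : wt R d1.+1 d2 i2 / vR = wt R d1 d2 i2.
Proof.
rewrite !wt2E [vR ^+ d1.+1]exprS; exact: (weight_other_shift _ _ _ (v_neq0 R)).
Qed.

Lemma wt2S2 d1 d2 : wt R d1 d2.+1 i2 * vR ^+ 2 = wt R d1 d2 i2.
Proof.
rewrite !wt2E [vR ^+ d2.+1]exprS; exact: (weight_own_shift _ _ _ (v_neq0 R)).
Qed.

(** [v] is not a root of unity and the Cartan matrix is invertible: equality
    for both [i] would give [d2 = 2 d1] and [d1 = 2 d2]. *)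
Lemma wt_neq_hwt d1 d2 : (d1, d2) != (0, 0)%N ->
  exists i, wt R d1 d2 i != hwt R i.
Proof.
move=> nd; have nX n : vR ^+ n != 0 by apply/expf_neq0/v_neq0.
have [e1|] := eqVneq (wt R d1 d2 i1) (hwt R i1); last by exists i1.
have [e2|] := eqVneq (wt R d1 d2 i2) (hwt R i2); last by exists i2.
move: e1 e2; rewrite wt1E wt2E.
move=> /(weight_fixed_eq (a1_neq0 R) (nX _)) e1.
move=> /(weight_fixed_eq (a2_neq0 R) (nX _)) e2; move: e1 e2.
rewrite -!exprM => /v_expn_inj e1 /v_expn_inj e2.
by exfalso; move/negP: nd; apply; apply/eqP; congr pair; lia.
Qed.

Section Pairing.

Variables (U : Uq_sl3 (v0 R)) (Ubar : Uq_sl3 (v0 R)^-1).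
Variables (sigma : {lrmorphism U -> Ubar}) (sigmaP : is_sigma sigma).
Variables (tau : {linear U -> U}) (tauP : is_tau tau).
Variables (V : Verma iota U (@hwt R)) (Vbar : Verma iota Ubar (@hwt_bar R)).
Variables (pair : V -> Vbar -> sqrt_ring iota).
Hypothesis pairP : is_Verma_pairing sigma tau pair.

Lemma pair_F i x y : pair (act (genF U i) x) y = pair x (act (genE Ubar i) y).
Proof. by rewrite (pair_act pairP) (tauF tauP) (sigmaE sigmaP). Qed.

Lemma pair_E i x y : pair (act (genE U i) x) y = pair x (act (genF Ubar i) y).
Proof. by rewrite (pair_act pairP) (tauE tauP) (sigmaF sigmaP). Qed.

Lemma pair_K i x y : pair (act (genK U i) x) y = pair x (act (genKinv Ubar i) y).
Proof. by rewrite (pair_act pairP) (tauK tauP) (sigmaK sigmaP). Qed.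

Lemma pair0l y : pair 0 y = 0.
Proof.
have /= := pair_linearl pairP y 1 0 0; rewrite scaler0 addr0 mul1r.
by move/eqP; rewrite -subr_eq0 opprD addNKr oppr_eq0 => /eqP.
Qed.

Lemma pair0r x : pair x 0 = 0.
Proof.
have /= := pair_linearr pairP x 1 0 0; rewrite scaler0 addr0 mul1r.
by move/eqP; rewrite -subr_eq0 opprD addNKr oppr_eq0 => /eqP.
Qed.

Lemma pairDl x1 x2 y : pair (x1 + x2) y = pair x1 y + pair x2 y.
Proof.
by have /= := pair_linearl pairP y 1 x1 x2; rewrite scale1r mul1r.
Qed.

Lemma pairZl c x y : pair (c *: x) y = c * pair x y.
Proof.
by have /= := pair_linearl pairP y c x 0; rewrite pair0l !addr0.
Qed.

Lemma pairZr c x y : pair x (c *: y) = c * pair x y.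
Proof.
by have /= := pair_linearr pairP x c y 0; rewrite pair0r !addr0.
Qed.

Lemma to_sqrt_ring_mulI (c : Cvl R) (r s : sqrt_ring iota) : c != 0 ->
  to_sqrt_ring iota c * r = to_sqrt_ring iota c * s -> r = s.
Proof.
move=> nc /(congr1 ( *%R (to_sqrt_ring iota c^-1))).
by rewrite !mulrA -rmorphM mulVf // rmorph1 !mul1r.
Qed.

(** A vector killed by [E_1] and [E_2] is orthogonal to the image of every
    [F_j], and one of a weight other than the highest is orthogonal to the
    highest weight vector. As monomials in the [F_j] span the dual Verma
    module, non-degeneracy of the pairing concludes. *)
Lemma singular_eq0 (k : 'I_2 -> Cvl R) (x : V) i :
  has_weight k x -> k i != hwt R i -> (forall j, act (genE U j) x = 0) -> x = 0.
Proof.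
move=> Kx nk Ex; apply: (pair_nondegl pairP) => y.
have nb : forall j, hwt_bar R j != 0.
  by move=> j; rewrite /hwt_bar /hwt invr_neq0 //; case: ifP => _;
    [apply: a1_neq0 | apply: a2_neq0].
have nv : (v0 R)^-1 != 0 by rewrite invr_neq0 ?v0_neq0.
have [hw_wt _] := Verma_vecP Vbar.
have Fy := Verma_Fspan nv nb y.
elim: Fy => [|c y1 y2 Fy1 _ IH]; first exact: pair0r.
have -> : pair x (c *: y1 + y2) = c * pair x y1 + pair x y2.
  exact: (pair_linearr pairP).
rewrite IH addr0; case: Fy1 => [|j z _]; last first.
  by rewrite -pair_E Ex pair0l mulr0.
have : pair (act (genK U i) x) (Verma_vec Vbar)
    = pair x (act (genKinv Ubar i) (Verma_vec Vbar)) by apply: pair_K.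
rewrite (act_Kinv (nb i) (hw_wt i)) Kx pairZl pairZr.
move/eqP; rewrite -subr_eq0 -mulrBl -rmorphB /hwt_bar invrK => /eqP kx0.
rewrite [pair x _](@to_sqrt_ring_mulI (k i - hwt R i) _ 0) ?mulr0 //.
by rewrite subr_eq0.
Qed.

End Pairing.

End Modules.

(** * Descent of Whittaker vectors *)

Section WhittakerFamilies.

Variables (R : realType) (L : closedFieldType) (iota : {rmorphism Cvl R -> L}).

Local Notation "c \: x" := (to_sqrt_ring iota c *: x)
  (at level 40, left associativity).
Local Notation vR := (v R).
Local Notation a1 := (vlam1 R / vlam2 R).
Local Notation a2 := (vlam2 R / vlam3 R).
Local Notation eps := ((1 - vR ^+ 2)^-1).
Local Notation wt1 d1 d2 := (wt R d1 d2 i1).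
Local Notation wt2 d1 d2 := (wt R d1 d2 i2).

Variables (U : Uq_sl3 (v0 R)) (M : Umodule iota U).
Implicit Types (f : nat -> nat -> M).

Local Notation K i := (act (genK U i)).
Local Notation E i := (act (genE U i)).
Local Notation F i := (act (genF U i)).

(** The Whittaker equations up to a scaling of the weights by [s1], [s2]. The
    scaling makes the notion stable under [lower1] and [lower2], so that the
    components with lowered indices, zero at the boundary, need no separate
    treatment. *)
Record Whittaker_family (s1 s2 : Cvl R) f : Prop := {
  family_K1 : forall d1 d2, K i1 (f d1 d2) = (wt1 d1 d2 * s1) \: f d1 d2;
  family_K2 : forall d1 d2, K i2 (f d1 d2) = (wt2 d1 d2 * s2) \: f d1 d2;
  family_E1 : forall d1 d2,
    E i1 (f d1 d2) = (eps * (wt1 d1 d2 * s1)) \: lower1 f d1 d2;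
  family_E2 : forall d1 d2, E i2 (f d1 d2) = eps \: lower2 f d1 d2
}.

Lemma family_lower1 s1 s2 f : Whittaker_family s1 s2 f ->
  Whittaker_family (s1 * vR ^+ 2) (s2 / vR) (lower1 f).
Proof.
case=> K1 K2 E1 E2.
have e1 d1 d2 : wt1 d1.+1 d2 * (s1 * vR ^+ 2) = wt1 d1 d2 * s1.
  by rewrite [s1 * _]mulrC mulrA wt1S1.
have e2 d1 d2 : wt2 d1.+1 d2 * (s2 / vR) = wt2 d1 d2 * s2.
  by rewrite [s2 * _]mulrC mulrA wt2S1.
split=> -[|d1] d2 /=; rewrite ?act0 ?scaler0 //.
- by rewrite K1 e1.
- by rewrite K2 e2.
- by rewrite E1 e1.
- by case: d2 => [|d2] /=; rewrite scaler0.
Qed.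

Lemma family_lower2 s1 s2 f : Whittaker_family s1 s2 f ->
  Whittaker_family (s1 / vR) (s2 * vR ^+ 2) (lower2 f).
Proof.
case=> K1 K2 E1 E2.
have e1 d1 d2 : wt1 d1 d2.+1 * (s1 / vR) = wt1 d1 d2 * s1.
  by rewrite [s1 * _]mulrC mulrA wt1S2.
have e2 d1 d2 : wt2 d1 d2.+1 * (s2 * vR ^+ 2) = wt2 d1 d2 * s2.
  by rewrite [s2 * _]mulrC mulrA wt2S2.
split=> d1 -[|d2] /=; rewrite ?act0 ?scaler0 //.
- by rewrite K1 e1.
- by rewrite K2 e2.
- by case: d1 => [|d1] /=; rewrite scaler0.
- by rewrite E1 e1; case: d1.
Qed.

Lemma scale0_combination (b c d e g : sqrt_ring iota) :
  b *: 0 = c *: 0 + d *: 0 + e *: 0 + g *: 0 :> M.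
Proof. by rewrite !scaler0 !addr0. Qed.

Lemma scale00_combination (c d e g : sqrt_ring iota) (x : M) :
  0 *: x = c *: 0 + d *: 0 + e *: 0 + g *: 0 :> M.
Proof. by rewrite !scaler0 !addr0 scale0r. Qed.

(** The descent relation expresses [omega_(d1,d2)] through the components with
    smaller indices. It is the action of the quadratic Casimir element on the
    Whittaker vector, once the Whittaker equations have turned every [E] into
    a shift of indices; it is stated for free [X] and [Y] in order to be used
    for lowered families, whose own indices are shifted. *)
Definition descent (X Y : Cvl R) f d1 d2 :=
  casimir_gap vR a1 a2 X Y \: f d1 d2 =
    Y ^+ 2 / (a2 * X ^+ 2) \: F i1 (lower1 f d1 d2)
    + vR ^+ 2 / X \: F i2 (lower2 f d1 d2)
    + (- X^-1) \: F i1 (F i2 (lower2 (lower1 f) d1 d2))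
    + (vR * X)^-1 \: F i2 (F i1 (lower2 (lower1 f) d1 d2)).

Lemma descent_lower1 f d1 d2 :
  (forall e1, d1 = e1.+1 -> descent (vR ^+ e1) (vR ^+ d2) f e1 d2) ->
  descent (vR ^+ d1 / vR) (vR ^+ d2) (lower1 f) d1 d2.
Proof.
case: d1 => [|d1] IH.
  rewrite /descent /= (_ : lower2 _ _ d2 = 0); last by case: d2 {IH}.
  rewrite (_ : lower2 _ _ d2 = 0); last by case: d2 {IH}.
  rewrite !act0; exact: scale0_combination.
have -> : vR ^+ d1.+1 / vR = vR ^+ d1 by rewrite exprSr mulfK ?v_neq0.
have := IH d1 erefl; rewrite /descent /=.
by case: d2 {IH}.
Qed.

Lemma descent_lower2 f d1 d2 :
  (forall e2, d2 = e2.+1 -> descent (vR ^+ d1) (vR ^+ e2) f d1 e2) ->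
  descent (vR ^+ d1) (vR ^+ d2 / vR) (lower2 f) d1 d2.
Proof.
case: d2 => [|d2] IH.
  rewrite /descent /= (_ : lower1 _ d1 _ = 0); last by case: d1 {IH}.
  rewrite !act0; exact: scale0_combination.
have -> : vR ^+ d2.+1 / vR = vR ^+ d2 by rewrite exprSr mulfK ?v_neq0.
have := IH d2 erefl; rewrite /descent lowerC /=.
by case: d1 {IH}.
Qed.

(** [E1] maps the relation at [(d1,d2)] to a consequence of the relation
    at [(d1-1,d2)]. *)
Lemma descent_E1 f d1 d2 : Whittaker_family 1 1 f ->
  descent (vR ^+ d1 / vR) (vR ^+ d2) (lower1 f) d1 d2 ->
  let X := vR ^+ d1 in let Y := vR ^+ d2 in
  casimir_gap vR a1 a2 X Y \: E i1 (f d1 d2) =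
    Y ^+ 2 / (a2 * X ^+ 2) \: E i1 (F i1 (lower1 f d1 d2))
    + vR ^+ 2 / X \: E i1 (F i2 (lower2 f d1 d2))
    + (- X^-1) \: E i1 (F i1 (F i2 (lower2 (lower1 f) d1 d2)))
    + (vR * X)^-1 \: E i1 (F i2 (F i1 (lower2 (lower1 f) d1 d2))).
Proof.
move=> fam IH X Y.
have nv := v_neq0 R; have nX : X != 0 := expf_neq0 d1 nv.
have nY : Y != 0 := expf_neq0 d2 nv.
have nk : wt1 d1 d2 != 0 by apply: wt_neq0.
have fam1 := family_lower1 fam; have fam2 := family_lower2 fam.
have fam12 := family_lower2 fam1.
have vvK : vR ^+ 2 / vR = vR by rewrite expr2 mulfK.
have Ek : wt1 d1 d2 = a1 * Y / X ^+ 2 by rewrite wt1E mulrA.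
have K1 := family_K1 fam1 d1 d2; rewrite mul1r in K1.
have K12 := family_K1 fam12 d1 d2; rewrite mul1r vvK in K12.
have KF12 : K i1 (F i2 (lower2 (lower1 f) d1 d2))
    = (wt1 d1 d2 * vR ^+ 2) \: F i2 (lower2 (lower1 f) d1 d2).
  by rewrite (act_KF i2 K12) /= -mulrA -expr2.
apply: (raise1_descent nv (a1_neq0 R) (a2_neq0 R) nX nY (v2B1_neq0 R) Ek
  _ _ _ _ _ IH).
- by rewrite (family_E1 fam) mulr1.
- rewrite (act_EF (mulf_neq0 nk (expf_neq0 2 nv)) K1) (family_E1 fam1) linearZ.
  by rewrite mul1r.
- by rewrite act_EF_neq // (family_E1 fam2) linearZ lowerC mul1r.
- rewrite (act_EF (mulf_neq0 nk (expf_neq0 2 nv)) KF12) act_EF_neq //.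
  by rewrite (family_E1 fam12) !linearZ lowerC mul1r vvK.
- rewrite act_EF_neq // (act_EF (mulf_neq0 nk nv) K12) linearD !linearZ.
  by rewrite (family_E1 fam12) !linearZ lowerC mul1r vvK.
Qed.

(** [E2] maps the relation at [(d1,d2)] to a consequence of the relation
    at [(d1,d2-1)]. *)
Lemma descent_E2 f d1 d2 : Whittaker_family 1 1 f ->
  descent (vR ^+ d1) (vR ^+ d2 / vR) (lower2 f) d1 d2 ->
  let X := vR ^+ d1 in let Y := vR ^+ d2 in
  casimir_gap vR a1 a2 X Y \: E i2 (f d1 d2) =
    Y ^+ 2 / (a2 * X ^+ 2) \: E i2 (F i1 (lower1 f d1 d2))
    + vR ^+ 2 / X \: E i2 (F i2 (lower2 f d1 d2))
    + (- X^-1) \: E i2 (F i1 (F i2 (lower2 (lower1 f) d1 d2)))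
    + (vR * X)^-1 \: E i2 (F i2 (F i1 (lower2 (lower1 f) d1 d2))).
Proof.
move=> fam IH X Y.
have nv := v_neq0 R; have nX : X != 0 := expf_neq0 d1 nv.
have nY : Y != 0 := expf_neq0 d2 nv.
have nk : wt2 d1 d2 != 0 by apply: wt_neq0.
have fam1 := family_lower1 fam; have fam2 := family_lower2 fam.
have fam12 := family_lower2 fam1.
have vvK : vR ^- 1 * vR ^+ 2 = vR by rewrite expr1 expr2 mulKf.
have Ek : wt2 d1 d2 = a2 * X / Y ^+ 2 by rewrite wt2E mulrA.
have K2 := family_K2 fam2 d1 d2; rewrite mul1r in K2.
have K12 := family_K2 fam12 d1 d2; rewrite mul1r vvK in K12.
have KF12 : K i2 (F i1 (lower2 (lower1 f) d1 d2))
    = (wt2 d1 d2 * vR ^+ 2) \: F i1 (lower2 (lower1 f) d1 d2).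
  by rewrite (act_KF i1 K12) /= -mulrA -expr2.
move: IH; rewrite /descent lowerC => IH.
apply: (raise2_descent nv (a1_neq0 R) (a2_neq0 R) nX nY (v2B1_neq0 R) Ek
  _ _ _ _ _ IH).
- exact: family_E2 fam _ _.
- by rewrite act_EF_neq // (family_E2 fam1) linearZ.
- by rewrite (act_EF (mulf_neq0 nk (expf_neq0 2 nv)) K2) (family_E2 fam2) linearZ.
- rewrite act_EF_neq // (act_EF (mulf_neq0 nk nv) K12) linearD !linearZ.
  by rewrite (family_E2 fam12) !linearZ.
- rewrite (act_EF (mulf_neq0 nk (expf_neq0 2 nv)) KF12) act_EF_neq //.
  by rewrite (family_E2 fam12) !linearZ.
Qed.

Lemma descent_weight f d1 d2 : Whittaker_family 1 1 f ->
  [/\ has_weight (wt R d1 d2) (f d1 d2),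
      has_weight (wt R d1 d2) (F i1 (lower1 f d1 d2)),
      has_weight (wt R d1 d2) (F i2 (lower2 f d1 d2)),
      has_weight (wt R d1 d2) (F i1 (F i2 (lower2 (lower1 f) d1 d2)))
    & has_weight (wt R d1 d2) (F i2 (F i1 (lower2 (lower1 f) d1 d2)))].
Proof.
move=> fam; have nv := v_neq0 R.
have fam1 := family_lower1 fam; have fam2 := family_lower2 fam.
have fam12 := family_lower2 fam1.
have vvK : vR ^+ 2 / vR = vR by rewrite expr2 mulfK.
have vvK' : vR ^- 1 * vR ^+ 2 = vR by rewrite expr1 expr2 mulKf.
have v2K (c : Cvl R) : c * vR ^+ 2 * vR ^- 2 = c by rewrite mulfK ?expf_neq0.
have vK (c : Cvl R) : c / vR * vR = c by rewrite mulfVK.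
have v12K (c : Cvl R) : c * vR * vR * vR ^- 2 = c.
  by rewrite -[c * _ * _]mulrA -expr2 mulfK ?expf_neq0.
have v21K (c : Cvl R) : c * vR * vR ^- 2 * vR = c by rewrite mulrAC v12K.
have weightP x : K i1 x = wt1 d1 d2 \: x -> K i2 x = wt2 d1 d2 \: x ->
    has_weight (wt R d1 d2) x.
  move=> x1 x2 i; have [->//|ni] := eqVneq i i1.
  by have -> : i = i2 by apply/val_inj; case: i ni => -[|[|]].
have K1 := family_K1 fam d1 d2; have K2 := family_K2 fam d1 d2.
rewrite !mulr1 in K1 K2.
have K11 := family_K1 fam1 d1 d2; have K12 := family_K2 fam1 d1 d2.
rewrite !mul1r in K11 K12.
have K21 := family_K1 fam2 d1 d2; have K22 := family_K2 fam2 d1 d2.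
rewrite !mul1r in K21 K22.
have K31 := family_K1 fam12 d1 d2; have K32 := family_K2 fam12 d1 d2.
rewrite mul1r vvK in K31; rewrite mul1r vvK' in K32.
split; apply: weightP => //.
- by rewrite (act_KF i1 K11) /= v2K.
- by rewrite (act_KF i1 K12) /= vK.
- by rewrite (act_KF i2 K21) /= vK.
- by rewrite (act_KF i2 K22) /= v2K.
- by rewrite (act_KF i1 (act_KF i2 K31)) /= v12K.
- by rewrite (act_KF i1 (act_KF i2 K32)) /= v21K.
- by rewrite (act_KF i2 (act_KF i1 K31)) /= v21K.
- by rewrite (act_KF i2 (act_KF i1 K32)) /= v12K.
Qed.

Lemma has_weightZ (k : 'I_2 -> Cvl R) c (x : M) :
  has_weight k x -> has_weight k (c *: x).
Proof. by move=> kx i; rewrite linearZ /= kx !scalerA mulrC. Qed.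

Lemma has_weightD (k : 'I_2 -> Cvl R) (x y : M) :
  has_weight k x -> has_weight k y -> has_weight k (x + y).
Proof. by move=> kx ky i; rewrite linearD /= kx ky scalerDr. Qed.

Lemma has_weightB (k : 'I_2 -> Cvl R) (x y : M) :
  has_weight k x -> has_weight k y -> has_weight k (x - y).
Proof. by move=> kx ky i; rewrite linearB /= kx ky scalerBr. Qed.

Lemma act_combination (u : U) (c0 c1 c2 c3 c4 : sqrt_ring iota)
    (x0 x1 x2 x3 x4 : M) :
  act u (c0 *: x0 - (c1 *: x1 + c2 *: x2 + c3 *: x3 + c4 *: x4))
  = c0 *: act u x0 - (c1 *: act u x1 + c2 *: act u x2 + c3 *: act u x3
                      + c4 *: act u x4).
Proof. by rewrite linearB !linearD !linearZ. Qed.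

Hypothesis singular0 : forall d1 d2 (x : M), (d1, d2) != (0, 0)%N ->
  has_weight (wt R d1 d2) x -> (forall i, E i x = 0) -> x = 0.

(** The difference of the two sides has the weight of [omega_(d1,d2)] and, by
    the relations at the smaller indices, is killed by [E_1] and [E_2]. *)
Lemma descent_step f d1 d2 : Whittaker_family 1 1 f -> (d1, d2) != (0, 0)%N ->
  descent (vR ^+ d1 / vR) (vR ^+ d2) (lower1 f) d1 d2 ->
  descent (vR ^+ d1) (vR ^+ d2 / vR) (lower2 f) d1 d2 ->
  descent (vR ^+ d1) (vR ^+ d2) f d1 d2.
Proof.
move=> fam nd IH1 IH2; apply/eqP; rewrite -subr_eq0; apply/eqP.
have [w0 w1 w2 w12 w21] := descent_weight d1 d2 fam.
apply: (singular0 nd).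
  apply: has_weightB; first exact: has_weightZ.
  by do 3?[apply: has_weightD]; apply: has_weightZ.
move=> i; have [->|ni] := eqVneq i i1.
  by rewrite act_combination (descent_E1 fam IH1) subrr.
have -> : i = i2 by apply/val_inj; case: i ni => -[|[|]].
by rewrite act_combination (descent_E2 fam IH2) subrr.
Qed.

Lemma descentP f d1 d2 : Whittaker_family 1 1 f ->
  descent (vR ^+ d1) (vR ^+ d2) f d1 d2.
Proof.
move=> fam; elim: d1 d2 => [|d1 IH1]; elim=> [|d2 IH2].
- have gap0 : casimir_gap vR a1 a2 (vR ^+ 0) (vR ^+ 0) = 0.
    by rewrite !expr0; apply: casimir_gap_one.
  have to0 : to_sqrt_ring iota 0 = 0 by apply: rmorph0.
  rewrite /descent gap0 to0 /= !act0; exact: scale00_combination.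
all: apply: descent_step => //.
- by apply: descent_lower1.
- by apply: descent_lower2 => e2 [<-].
- by apply: descent_lower1 => e1 [<-].
- by apply: descent_lower2.
- by apply: descent_lower1 => e1 [<-].
- by apply: descent_lower2 => e2 [<-].
Qed.

End WhittakerFamilies.

(** * The recursion for the pairing *)

Section PairingRecursion.

Variables (R : realType) (L : closedFieldType) (iota : {rmorphism Cvl R -> L}).
Variables (U : Uq_sl3 (v0 R)) (Ubar : Uq_sl3 (v0 R)^-1).
Variables (sigma : {lrmorphism U -> Ubar}) (sigmaP : is_sigma sigma).
Variables (tau : {linear U -> U}) (tauP : is_tau tau).
Variables (V : Verma iota U (@hwt R)) (Vbar : Verma iota Ubar (@hwt_bar R)).
Variables (pair : V -> Vbar -> sqrt_ring iota).
Hypothesis pairP : is_Verma_pairing sigma tau pair.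
Variables (omega : nat -> nat -> V) (omegaP : is_Whittaker omega).
Variables (omegabar : nat -> nat -> Vbar).
Hypothesis omegabarP : is_dual_Whittaker omegabar.

Local Notation "c \: x" := (to_sqrt_ring iota c *: x)
  (at level 40, left associativity).
Local Notation vR := (v R).
Local Notation a1 := (vlam1 R / vlam2 R).
Local Notation a2 := (vlam2 R / vlam3 R).
Local Notation eta := (vR / (1 - vR ^- 2)).
Local Notation in_ring := (to_sqrt_ring iota).

Lemma omega_family : Whittaker_family 1 1 omega.
Proof.
have [wt_omega _ E1 E2] := omegaP.
split=> d1 d2; rewrite ?mulr1; try exact: wt_omega; last exact: E2.
rewrite (act_E_EKinv (wt_neq0 R _ _ _) (wt_omega d1 d2 i1)) E1.
by rewrite scale_scalarA mulrC.
Qed.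

Lemma omega_descent d1 d2 : descent (vR ^+ d1) (vR ^+ d2) omega d1 d2.
Proof.
apply: descentP omega_family => e1 e2 x nd wx Ex.
have [i ni] := wt_neq_hwt R nd.
exact: (singular_eq0 sigmaP tauP pairP wx ni Ex).
Qed.

Lemma omegabar_E2 d1 d2 :
  act (genE Ubar i2) (omegabar d1 d2)
  = (wt R d1 d2 i2 * eta) \: lower2 omegabar d1 d2.
Proof.
have [wt_omegabar _ _ E2] := omegabarP.
have := E2 d1 d2; rewrite actM wt_omegabar linearZ /= => EK.
by rewrite -scale_scalarA -EK scale_scalarA mulfV ?wt_neq0 // rmorph1 scale1r.
Qed.

Lemma omegabar_E2_lower1 d1 d2 :
  act (genE Ubar i2) (lower1 omegabar d1 d2)
  = (wt R d1 d2 i2 / vR * eta) \: lower2 (lower1 omegabar) d1 d2.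
Proof.
case: d1 => [|d1] /=.
  by rewrite act0; case: d2 => [|d2] /=; rewrite scaler0.
by rewrite omegabar_E2 -wt2S1; case: d2.
Qed.

Lemma omegabar_E1_lower2 d1 d2 :
  act (genE Ubar i1) (lower2 omegabar d1 d2)
  = eta \: lower2 (lower1 omegabar) d1 d2.
Proof.
case: d2 => [|d2] /=; first by rewrite act0 scaler0.
exact: dual_Whittaker1.
Qed.

Definition whittaker_pairing d1 d2 := pair (omega d1 d2) (omegabar d1 d2).

Lemma pair_combination (c0 c1 c2 c3 c4 : sqrt_ring iota) x0 x1 x2 x3 x4 y :
  c0 *: x0 = c1 *: x1 + c2 *: x2 + c3 *: x3 + c4 *: x4 ->
  c0 * pair x0 y
  = c1 * pair x1 y + c2 * pair x2 y + c3 * pair x3 y + c4 * pair x4 y.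
Proof. by move=> e; rewrite -!(pairZl pairP) e !(pairDl pairP). Qed.

(** The descent relation paired with [omegabar_(d1,d2)]: each [F_i] becomes
    [E_i] on the dual side, where the dual Whittaker equations apply, and the
    terms in [F1 F2] and [F2 F1] cancel. *)
Lemma whittaker_pairing_toda d1 d2 : let X := vR ^+ d1 in let Y := vR ^+ d2 in
  in_ring (casimir_gap vR a1 a2 X Y) * whittaker_pairing d1 d2
  = in_ring (Y ^+ 2 / (a2 * X ^+ 2) * eta) * lower1 whittaker_pairing d1 d2
    + in_ring (vR ^+ 2 * a2 / Y ^+ 2 * eta) * lower2 whittaker_pairing d1 d2.
Proof.
move=> X Y; have nv := v_neq0 R.
have nX : X != 0 := expf_neq0 d1 nv.
have nY : Y != 0 := expf_neq0 d2 nv.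
have [coef2 coef12] := pairing_coefficients eta nv nX nY (wt2E R d1 d2).
have pFE := pair_F sigmaP tauP pairP; have pZ := pairZr pairP.
have E21 : act (genE Ubar i2) (act (genE Ubar i1) (omegabar d1 d2))
    = (eta * (wt R d1 d2 i2 / vR * eta)) \: lower2 (lower1 omegabar) d1 d2.
  rewrite (dual_Whittaker1 omegabarP) linearZ /= omegabar_E2_lower1.
  exact: scale_scalarA.
have E12 : act (genE Ubar i1) (act (genE Ubar i2) (omegabar d1 d2))
    = (wt R d1 d2 i2 * eta * eta) \: lower2 (lower1 omegabar) d1 d2.
  by rewrite omegabar_E2 linearZ /= omegabar_E1_lower2 scale_scalarA.
rewrite (pair_combination _ (omega_descent d1 d2)) !pFE E21 E12.
rewrite (dual_Whittaker1 omegabarP) omegabar_E2 !pZ.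
rewrite (combine_coefficients _ _ _ _ _ _ coef2 coef12); congr (_ * _ + _ * _).
- by case: d1 {X nX coef2 coef12 E21 E12} => [|d1] //=; apply: (pair0l pairP).
- by case: d2 {Y nY coef2 coef12 E21 E12} => [|d2] //=; apply: (pair0l pairP).
Qed.

End PairingRecursion.

Theorem corollary8p8 (R : realType)
    (L : closedFieldType) (iota : {rmorphism Cvl R -> L})
    (closL : is_algebraic_closure iota)
    (U : Uq_sl3 (v0 R)) (Ubar : Uq_sl3 (v0 R)^-1)
    (sigma : {lrmorphism U -> Ubar}) (sigmaP : is_sigma sigma)
    (tau : {linear U -> U}) (tauP : is_tau tau)
    (V : Verma iota U (@hwt R)) (Vbar : Verma iota Ubar (@hwt_bar R))
    (pair : V -> Vbar -> sqrt_ring iota) (pairP : is_Verma_pairing sigma tau pair)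
    (omega : nat -> nat -> V) (omegaP : is_Whittaker omega)
    (omegabar : nat -> nat -> Vbar) (omegabarP : is_dual_Whittaker omegabar)
    (d1 d2 : nat) :
  to_sqrt_ring iota (Ifun d1 d2 (z1 R) (z2 R)) = pair (omega d1 d2) (omegabar d1 d2).
Proof.
pose Jd := whittaker_pairing pair omega omegabar.
have Jrec := whittaker_pairing_toda sigmaP tauP pairP omegaP omegabarP.
have step d e : (d, e) != (0, 0)%N ->
    to_sqrt_ring iota (lower1 (@Iz R) d e) = lower1 Jd d e ->
    to_sqrt_ring iota (lower2 (@Iz R) d e) = lower2 Jd d e ->
    to_sqrt_ring iota (Iz R d e) = Jd d e.
  move=> nd IH1 IH2; apply: (to_sqrt_ring_mulI (casimir_gap_weight_neq0 R nd)).
  have -> := Jrec d e.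
  rewrite -rmorphM Iz_toda rmorph_combination; congr (_ * _ + _ * _).
  - exact: IH1.
  - exact: IH2.
have to0 : to_sqrt_ring iota 0 = 0 by apply: rmorph0.
suff main d e : to_sqrt_ring iota (Iz R d e) = Jd d e by exact: main.
elim: d e => [|d IH1]; elim=> [|e IH2].
- rewrite /Jd /whittaker_pairing (Whittaker00 omegaP) (dual_Whittaker00 omegabarP).
  by rewrite (pair_vec pairP) /Iz Ifun00; apply: rmorph1.
- exact: (step 0%N e.+1 isT to0 IH2).
- exact: (step d.+1 0%N isT (IH1 0%N) to0).
- exact: (step d.+1 e.+1 isT (IH1 e.+1) IH2).
Qed.
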